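(* Let $k\ge 1$ be an integer, let $a^{(1)},\dots,a^{(k)}\in\mathbb R$ with $a^{(k)}\neq 0$, let $\mu=|\mu|e^{i\varphi}\in\mathbb C\setminus\mathbb R$, $s\in\mathbb N$ and $f\in L_{\mu,C}^s$. Consider the difference equation $$y_{n+k}+a^{(1)}y_{n+k-1}+\dots+a^{(k)}y_n=f_n ,$$ i.e. $Ry=f$ with $R=T^k+a^{(1)}T^{k-1}+\dots+a^{(k)}I$, for an unknown $y\in S_{\mathbb R}$. 1. Suppose $\mu$ is not a characteristic number of the equation. Then the equation has a particular solution $y^{(0)}\in L_{\mu,C}^s$, and its coefficient column $\mathbf y$ in the basis $$\{|\mu|^n\sin n\varphi,\ |\mu|^n\cos n\varphi,\ n|\mu|^n\sin n\varphi,\ n|\mu|^n\cos n\varphi,\dots,n^s|\mu|^n\sin n\varphi,\ n^s|\mu|^n\cos n\varphi\}$$ can be found from the linear system $R_{\mu,C}^s\,\mathbf y=\mathbf f$, where $R_{\mu,C}^s=(\mathcal T_{\mu,C}^s)^k+a^{(1)}(\mathcal T_{\mu,C}^s)^{k-1}+\dots+a^{(k)}I$ and $\mathbf f$ is the coefficient column of $f$ in the same basis. This system has a unique solution. 2. Suppose $\mu$ is a characteristic number of the equation of multiplicity $m\ge 1$. Then the equation has a particular solution $y^{(0)}\in L_{\mu,C}^{m+s}=K_{\mu,C}^m\oplus L_{\mu,C}^{m,s}$, where $$K_{\mu,C}^m=\operatorname{span}\{|\mu|^n\sin n\varphi,|\mu|^n\cos n\varphi,\dots,n^{m-1}|\mu|^n\sin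 n\varphi,n^{m-1}|\mu|^n\cos n\varphi\}=\ker R|_{L_{\mu,C}^{m+s}},$$ $$L_{\mu,C}^{m,s}=\operatorname{span}\{n^m|\mu|^n\sin n\varphi,n^m|\mu|^n\cos n\varphi,\dots,n^{m+s}|\mu|^n\sin n\varphi,n^{m+s}|\mu|^n\cos n\varphi\}.$$ The coefficient column $\mathbf y_p$, in the displayed (ordered) basis of $L_{\mu,C}^{m,s}$, of the projection of $y^{(0)}$ onto $L_{\mu,C}^{m,s}$ (along $K_{\mu,C}^m$) can be found from the linear system $R_{\mu,C}^{m,s}\,\mathbf y_p=\mathbf f$, where $R_{\mu,C}^{m,s}$ is the $2(s+1)\times 2(s+1)$ matrix obtained by deleting the first $2m$ columns and the last $2m$ rows of the matrix $(\mathcal T_{\mu,C}^{m+s})^k+a^{(1)}(\mathcal T_{\mu,C}^{m+s})^{k-1}+\dots+a^{(k)}I$, and $\mathbf f$ is the coefficient column of $f$ in the basis of $L_{\mu,C}^s$ displayed in part 1. This system has a unique solution.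
   Context: $\mathbb N_0=\{0,1,2,\dots\}$, $e_0=(1,0,0,\dots)$. $S_{\mathbb R}$ is the real vector space of real-valued sequences indexed by $\mathbb N_0$ modulo $\operatorname{span}\{e_0\}$ (so sequences are identified when they agree except possibly at index $0$). $T$ is the shift operator $(Ty)_n=y_{n+1}$, which is well defined on $S_{\mathbb R}$ since $Te_0=0$; $I$ denotes the identity operator (or identity matrix). Expressions such as $n^j|\mu|^n\sin n\varphi$ denote the corresponding sequence indexed by $n\ge0$ (with $n^0=1$) and its class in $S_{\mathbb R}$. For $\mu=|\mu|e^{i\varphi}$ with nonzero imaginary part and $s\in\mathbb N$, $L_{\mu,C}^s\subset S_{\mathbb R}$ is the real span of $n^j|\mu|^n\sin n\varphi,\ n^j|\mu|^n\cos n\varphi$, $0\le j\le s$; this is a $T$-invariant subspace of dimension $2(s+1)$. $\mathcal T_{\mu,C}^s$ is the matrix of the restriction $T|_{L_{\mu,C}^s}$ in the ordered basis $\{|\mu|^n\sin n\varphi,|\mu|^n\cos n\varphi,n|\mu|^n\sin n\varphi,n|\mu|^n\cos n\varphi,\dots,n^s|\mu|^n\sin n\varphi,n^s|\mu|^n\cos n\varphi\}$ (the $j$-th column holds the coordinates of the image of the $j$-th basis vector). A characteristic number of the equation is a (complex) root of $\lambda^k+a^{(1)}\lambda^{k-1}+\dots+a^{(k)}$, and its multiplicity is its multiplicity as a root. ''Can be found from the system'' means: a column is the coefficient column of a particular solution in the stated space (respectively, of the projection of such a solution) if and only if it solves the system. *)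

(* Defs.v *)
From HB Require Import structures.
From mathcomp Require Import all_boot all_order all_algebra.
From mathcomp Require Import all_classical all_reals all_analysis.
From mathcomp Require Import complex.

Set Implicit Arguments.
Unset Strict Implicit.
Unset Printing Implicit Defensive.

Import Order.TTheory GRing.Theory Num.Theory.

Local Open Scope classical_set_scope.
Local Open Scope ring_scope.
Local Open Scope quotient_scope.

(* [SR] is the quotient of the real sequences by the line spanned by [e0];
   by [cls_eqP], two sequences have the same class when they agree at every
   index [n >= 1]. *)
Section SequenceSpace.
Variable R : realType.

Definition rseq : Type := nat -> R^o.
HB.instance Definition _ := Choice.on rseq.
HB.instance Definition _ := GRing.Lmodule.on rseq.

Definition e0 : rseq := fun n => (n == 0%N)%:R.

Definition span_e0 : {pred rseq} := fun y => `[< exists c : R, y = c *: e0 >].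

Lemma span_e0_closed : zmod_closed span_e0.
Proof.
split=> [|x y /asboolP[a ->] /asboolP[b ->]]; apply/asboolP.
  by exists 0; rewrite scale0r.
by exists (a - b); rewrite scalerBl.
Qed.

HB.instance Definition _ := GRing.isZmodClosed.Build rseq span_e0 span_e0_closed.

Definition SR : Type := Quotient.quot span_e0.
HB.instance Definition _ := Choice.on SR.
HB.instance Definition _ := GRing.Zmodule.on SR.

Definition cls (y : rseq) : SR := \pi_(Quotient.quot span_e0) y.

Lemma cls_eqP (x y : rseq) :
  cls x = cls y <-> (forall n, (0 < n)%N -> x n = y n).
Proof.
rewrite /cls; split=> [/eqP|xy].
  rewrite -Quotient.idealrBE => /asboolP[c /(congr1 (fun u : rseq => u _)) xy].
  move=> [//|n] _; apply/eqP; rewrite -subr_eq0; apply/eqP.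
  exact: etrans (xy n.+1) (mulr0 c).
apply/eqP; rewrite -Quotient.idealrBE; apply/asboolP; exists (x 0%N - y 0%N).
apply/funext => -[|n]; first by rewrite /e0; exact/esym/mulr1.
have -> : (x - y) n.+1 = x n.+1 - y n.+1 by [].
by rewrite xy// subrr; exact/esym/mulr0.
Qed.

Lemma cls_repr (x : SR) : cls (repr x) = x.
Proof. exact: reprK. Qed.

Lemma clsD (x y : rseq) : cls (x + y) = cls x + cls y.
Proof. exact: raddfD. Qed.

Definition scaleS (c : R) (x : SR) : SR := cls (c *: repr x).

Lemma clsZ c (y : rseq) : cls (c *: y) = scaleS c (cls y).
Proof.
apply/cls_eqP => n n0; congr (_ * _).
by have /cls_eqP/(_ n n0) := cls_repr (cls y).
Qed.

Fact scaleSA a b x : scaleS a (scaleS b x) = scaleS (a * b) x.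
Proof. by rewrite {2}/scaleS -clsZ scalerA. Qed.

Fact scaleS1 : left_id 1 scaleS.
Proof. by move=> x; rewrite /scaleS scale1r cls_repr. Qed.

Fact scaleSDr : right_distributive scaleS +%R.
Proof.
by move=> c x y; rewrite -(cls_repr x) -(cls_repr y) -clsD -!clsZ -clsD scalerDr.
Qed.

Fact scaleSDl x : {morph scaleS^~ x : a b / a + b}.
Proof. by move=> a b; rewrite /scaleS scalerDl clsD. Qed.

HB.instance Definition _ :=
  GRing.Zmodule_isLmodule.Build R SR scaleSA scaleS1 scaleSDr scaleSDl.

Definition shift (y : rseq) : rseq := fun n => y n.+1.

Definition T (x : SR) : SR := cls (shift (repr x)).

Lemma T_cls (y : rseq) : T (cls y) = cls (shift y).
Proof.
by apply/cls_eqP => n _; have /cls_eqP/(_ n.+1 isT) := cls_repr (cls y).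
Qed.

Lemma T_linear : linear T.
Proof.
move=> c x y; rewrite -(cls_repr x) -(cls_repr y).
by rewrite -[c *: _]clsZ -clsD !T_cls clsD clsZ.
Qed.

HB.instance Definition _ := GRing.isLinear.Build R SR SR _ T T_linear.

End SequenceSpace.

Section FiniteFamilies.
Variables (R : realType) (V : lmodType R).

Definition comb d (b : 'I_d -> V) (c : 'cV[R]_d) : V := \sum_i c i 0 *: b i.

Definition spanf d (b : 'I_d -> V) : set V := range (comb b).

(* Choice makes this total; it is the usual coefficient column when [b] is
   linearly independent and [v] lies in [spanf b]. *)
Definition coefcol d (b : 'I_d -> V) (v : V) : 'cV[R]_d :=
  xget 0 [set c | v = comb b c].

Definition opmx d (b : 'I_d -> V) (F : V -> V) : 'M[R]_d :=
  \matrix_(i, j) coefcol b (F (b j)) i 0.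

Definition direct_sum (W U1 U2 : set V) : Prop :=
  W = [set u1 + u2 | u1 in U1 & u2 in U2] /\ U1 `&` U2 = [set 0].

(* [u] is the projection of [v] onto [U] along [K]; it is unique as soon as
   [U `&` K = [set 0]]. *)
Definition is_proj (U K : set V) (v u : V) : Prop := U u /\ K (v - u).

End FiniteFamilies.

Section Equation.
Variable R : realType.
Implicit Types (k m s : nat) (a : nat -> R) (mu : R[i]) (phi : R).

(* The equation is [y_(n+k) + a 1 * y_(n+k-1) + ... + a k * y_n = f_n]; only
   the values [a 1, ..., a k] of [a : nat -> R] are used. *)
Definition charpoly_eq k a : {poly R} :=
  'X^k + \sum_(1 <= i < k.+1) a i *: 'X^(k - i).

Definition Rop k a (y : SR R) : SR R :=
  iter k (@T R) y + \sum_(1 <= i < k.+1) a i *: iter (k - i) (@T R) y.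

Definition polymx k a d (M : 'M[R]_d) : 'M[R]_d :=
  M ^+ k + \sum_(1 <= i < k.+1) a i *: M ^+ (k - i).

Definition cabs mu : R := ComplexField.Normc.normc mu.

Definition is_arg mu phi : Prop :=
  mu = (real_complex R (cabs mu)) * Complex (cos phi) (sin phi).

(* Term number [2j] is [n^j |mu|^n sin (n phi)], term number [2j+1] is
   [n^j |mu|^n cos (n phi)]. *)
Definition bseq mu phi (i : nat) : rseq R := fun n =>
  n%:R ^+ i./2 * cabs mu ^+ n *
  (if odd i then cos (n%:R * phi) else sin (n%:R * phi)).

Definition basL mu phi s : 'I_(2 * s.+1) -> SR R :=
  fun i => cls (bseq mu phi i).

Definition basK mu phi m : 'I_(2 * m) -> SR R :=
  fun i => cls (bseq mu phi i).

Definition basLm mu phi m s : 'I_(2 * s.+1) -> SR R :=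
  fun i => cls (bseq mu phi (2 * m + i)%N).

Arguments basL : clear implicits.
Arguments basK : clear implicits.
Arguments basLm : clear implicits.

Definition spL mu phi s : set (SR R) := spanf (basL mu phi s).
Definition spK mu phi m : set (SR R) := spanf (basK mu phi m).
Definition spLm mu phi m s : set (SR R) := spanf (basLm mu phi m s).

Definition Tmx mu phi s : 'M[R]_(2 * s.+1) := opmx (basL mu phi s) (@T R).

Definition Rmx k a mu phi s : 'M[R]_(2 * s.+1) := polymx k a (Tmx mu phi s).

Lemma dim_le m s : (2 * s.+1 <= 2 * (m + s).+1)%N.
Proof. by rewrite leq_mul2l ltnS leq_addl. Qed.

Lemma dim_eq m s : (2 * m + 2 * s.+1 = 2 * (m + s).+1)%N.
Proof. by rewrite -mulnDr addnS. Qed.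

(* Rows [0 .. 2(s+1)-1] are kept (the last [2m] go), and columns
   [2m .. 2(m+s+1)-1] are kept (the first [2m] go). *)
Definition Rmx_del k a mu phi m s : 'M[R]_(2 * s.+1) :=
  mxsub (widen_ord (dim_le m s))
        (fun j => cast_ord (dim_eq m s) (rshift (2 * m) j))
        (Rmx k a mu phi (m + s)).

End Equation.

Arguments basL {R} mu phi s i.
Arguments basK {R} mu phi m i.
Arguments basLm {R} mu phi m s i.

(* Main.v *)
Require Import Defs.
From HB Require Import structures.
From mathcomp Require Import all_boot all_order all_algebra.
From mathcomp Require Import all_classical all_reals all_analysis.
From mathcomp Require Import complex.
From mathcomp Require Import ring.

Set Implicit Arguments.
Unset Strict Implicit.
Unset Printing Implicit Defensive.

Import Order.TTheory GRing.Theory Num.Theory.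
Local Open Scope classical_set_scope.
Local Open Scope ring_scope.

(** The equation is solved on polynomials instead of sequences.  Every element
    of the spans in question is the class of [n |-> Re (q(n) mu^n)] for a
    complex polynomial [q] ([quasi]): the basis terms
    [n^j |mu|^n cos (n phi)] and [n^j |mu|^n sin (n phi)] come from ['X^j] and
    [-i 'X^j] ([cls_bseq]).  As [mu] is not real, [q] is determined by its
    class ([quasi_inj]), so the bases are linearly independent and each span is
    described by a condition on the real and imaginary parts of the
    coefficients of [q] ([spanf_famP]).

    The shift multiplies [q(x)] by [mu] and replaces [x] by [x + 1].  By
    Taylor's formula an equation with characteristic polynomial [P] acts on
    polynomials as [shiftop P q = sum_e w_e q^(e) / e!], where
    [w_e = sum_i P_i mu^i i^e] is the value at [mu] of the Euler derivative
    [('X d/d'X)^e P].  If [m] is the multiplicity of [mu] as a root of [P],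
    then [w_e = 0] for [e < m] and [w_m != 0] ([weight_mup]).  Thus [shiftop P]
    lowers degrees by exactly [m]: its kernel consists of the polynomials of
    degree less than [m] ([shiftop_eq0]), and it maps the polynomials
    ['X^m * p] with [deg p <= s] onto those of degree at most [s]
    ([shiftop_onto]).

    Consequently the operator of the equation is a bijection from the span of
    the [n^(m+j) |mu|^n sin (n phi)], [n^(m+j) |mu|^n cos (n phi)], [j <= s],
    onto the span of the terms with [n^j] ([Rop_comb_onto], [Rop_comb_inj]),
    and the trimmed matrix represents it: the deleted columns belong to its
    kernel, and the deleted rows vanish on the remaining columns
    ([comb_Rmx_del]).  A root and a non-root [mu] are treated together, the
    latter being the case [m = 0]. *)

(** * The shift on polynomials *)

Section ShiftOperator.
Variables (F : numFieldType) (mu : F).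
Implicit Types P Q q g : {poly F}.

Definition euler P := 'X * P^`().

(** This is [sum_i P_i mu^i i^e] (see [weightXn]); writing it with Euler
    derivatives is what relates it to the order of vanishing of [P] at [mu]. *)
Definition weight P e := (iter e euler P).[mu].

Lemma weight_linear e c P Q :
  weight (c *: P + Q) e = c * weight P e + weight Q e.
Proof.
rewrite /weight; have -> : iter e euler (c *: P + Q) =
    c *: iter e euler P + iter e euler Q.
  elim: e => //= e ->.
  by rewrite /euler derivD derivZ mulrDr scalerAr.
by rewrite hornerD hornerZ.
Qed.

Lemma weightXn j e : weight 'X^j e = j%:R ^+ e * mu ^+ j.
Proof.
rewrite /weight; have -> : iter e euler 'X^j = (j%:R ^+ e) *: 'X^j.
  elim: e => [|e /= ->]; first by rewrite scale1r.
  rewrite /euler derivZ derivXn -scalerAr mulrnAr -exprS.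
  case: j => [|j]; first by rewrite !mulr0n scaler0 exprS mul0r scale0r.
  by rewrite -scaler_nat scalerA [_ ^+ e.+1]exprSr.
by rewrite hornerZ hornerXn.
Qed.

(** One Euler derivative takes [('X - mu)^m.+1 Q] to [('X - mu)^m Q'] where
    [Q'(mu) = (m + 1) mu Q(mu)], so the order of vanishing at [mu] drops by
    one each time and the leading value stays nonzero. *)
Lemma weight_XsubC_exp m Q e : (e <= m)%N ->
  weight (('X - mu%:P) ^+ m * Q) e =
  if e == m then mu ^+ m * Q.[mu] *+ m`! else 0.
Proof.
elim: e m Q => [|e IHe] [|m] Q //.
- by rewrite /weight /= expr0 !mul1r.
- by rewrite /weight /= exprS -mulrA hornerM hornerXsubC subrr mul0r.
rewrite ltnS eqSS => em.
have step : euler (('X - mu%:P) ^+ m.+1 * Q) =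
    ('X - mu%:P) ^+ m * ('X * (Q *+ m.+1 + ('X - mu%:P) * Q^`())).
  rewrite /euler derivM deriv_exp derivXsubC mul1r /= mulrCA; congr (_ * _).
  by rewrite mulrDr mulrnAl mulrnAr exprSr mulrA.
rewrite /weight iterSr step -/(weight _ _) IHe//; case: eqP => // _.
rewrite hornerM hornerX hornerD hornerMn hornerM hornerXsubC subrr mul0r addr0.
by rewrite !mulrnAr -mulrnA mulrA -exprSr factS.
Qed.

Lemma weight_mup P : mu != 0 -> P != 0 ->
  (forall e, (e < mup mu P)%N -> weight P e = 0) /\ weight P (mup mu P) != 0.
Proof.
move=> mu0 P0; set m := mup mu P.
have /dvdpP[Q PE] : ('X - mu%:P) ^+ m %| P by rewrite -mup_geq.
have Qmu : Q.[mu] != 0.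
  apply/negP => /factor_theorem[Q' QE].
  have := leqnn (mup mu P); rewrite mup_leq // -/m => /negP; apply.
  by rewrite PE QE -mulrA -exprS dvdp_mull.
rewrite PE mulrC; split=> [e em|]; rewrite weight_XsubC_exp ?(ltnW em)//.
  by rewrite ltn_eqF.
by rewrite eqxx mulrn_eq0 negb_or -lt0n fact_gt0 mulf_neq0 // expf_neq0.
Qed.

(** This is [P (mu S)] applied to [q], where [S] is the translation
    [q(x) |-> q(x + 1)], with the powers of [S] expanded by Taylor's formula
    (see [horner_shiftopXn]).  The expansion by derivatives shows the effect on
    degrees. *)
Definition shiftop P q := \sum_(e < size q) weight P e *: q^`N(e).

Lemma shiftop_wide N P q : (size q <= N)%N ->
  shiftop P q = \sum_(e < N) weight P e *: q^`N(e).
Proof.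
move=> qN; rewrite /shiftop.
rewrite (big_ord_widen N (fun e => weight P e *: q^`N(e)))//.
rewrite big_mkcond; apply: eq_bigr => e _; case: leqP => // /nderivn_poly0 ->.
by rewrite scaler0.
Qed.

Lemma shiftop_linearr P c q g :
  shiftop P (c *: q + g) = c *: shiftop P q + shiftop P g.
Proof.
pose N := maxn (size (c *: q + g)) (maxn (size q) (size g)).
rewrite !(@shiftop_wide N) ?leq_max ?leqnn ?orbT// scaler_sumr -big_split /=.
apply: eq_bigr => e _.
by rewrite nderivnD nderivnZ scalerDr !scalerA [c * _]mulrC.
Qed.

Lemma shiftop_linearl c P Q q :
  shiftop (c *: P + Q) q = c *: shiftop P q + shiftop Q q.
Proof.
rewrite /shiftop scaler_sumr -big_split /=; apply: eq_bigr => e _.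
by rewrite weight_linear scalerDl scalerA.
Qed.

Lemma horner_shiftopXn j q x : (shiftop 'X^j q).[x] = q.[x + j%:R] * mu ^+ j.
Proof.
rewrite /shiftop horner_sum nderiv_taylor; last exact: mulrC.
rewrite mulr_suml; apply: eq_bigr => e _.
by rewrite hornerZ weightXn mulrC mulrA.
Qed.

Lemma coef_shiftop N P q j : (size q <= N)%N ->
  (shiftop P q)`_j = \sum_(e < N) weight P e * (q`_(e + j) *+ 'C(e + j, e)).
Proof.
move=> qN; rewrite (shiftop_wide _ qN) coef_sum; apply: eq_bigr => e _.
by rewrite coefZ coef_nderivn.
Qed.

Section Order.
Variables (P : {poly F}) (m : nat).
Hypothesis weight_lt : forall e, (e < m)%N -> weight P e = 0.
Hypothesis weight_m : weight P m != 0.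

Lemma coef_shiftop_top q n : (size q <= (m + n).+1)%N ->
  (shiftop P q)`_n = weight P m * (q`_(m + n) *+ 'C(m + n, m)).
Proof.
move=> qmn; rewrite (coef_shiftop _ _ qmn).
have mlt : (m < (m + n).+1)%N by rewrite ltnS leq_addr.
rewrite (bigD1 (Ordinal mlt)) //= big1 ?addr0// => e; rewrite -val_eqE /= => em.
have [/weight_lt ->|me] := ltnP e m; first by rewrite mul0r.
rewrite nth_default ?mul0rn ?mulr0//.
by rewrite (leq_trans qmn)// ltn_add2r ltn_neqAle eq_sym em.
Qed.

Lemma size_shiftop q n : (size q <= m + n)%N -> (size (shiftop P q) <= n)%N.
Proof.
move=> qmn; apply/leq_sizeP => j nj; rewrite coef_shiftop_top.
  by rewrite nth_default ?mul0rn ?mulr0// (leq_trans qmn)// leq_add2l.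
by rewrite (leq_trans qmn)// leqW// leq_add2l.
Qed.

(** If [deg q = m + n], the coefficient of degree [n] in the image is
    [weight P m * 'C(m + n, m)] times the leading coefficient of [q]. *)
Lemma shiftop_eq0 q : shiftop P q = 0 -> (size q <= m)%N.
Proof.
move=> q0; rewrite leqNgt; apply/negP => mq.
have sq : size q = (m + (size q - m.+1)).+1 by rewrite -addSn subnKC.
have := @coef_shiftop_top q (size q - m.+1); rewrite -sq leqnn => /(_ isT).
rewrite q0 coef0 => /esym/eqP; rewrite mulf_eq0 (negPf weight_m) /=.
rewrite mulrn_eq0 -leqn0 leqNgt bin_gt0 leq_addr /=.
have -> : (m + (size q - m.+1))%N = (size q).-1 by rewrite [in RHS]sq.
rewrite -/(lead_coef q) lead_coef_eq0 => /eqP q00.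
by rewrite q00 size_poly0 in mq.
Qed.

(** The preimage is built from its top coefficient downwards, which needs only
    monomials of degree at least [m]. *)
Lemma shiftop_onto n g : (size g <= n)%N ->
  exists q, [/\ forall j, (j < m)%N -> q`_j = 0, (size q <= m + n)%N
              & shiftop P q = g].
Proof.
elim: n g => [|n IHn] g gn.
  exists 0; split=> [j _||]; rewrite ?coef0 ?size_poly0//.
  rewrite /shiftop size_poly0 big_ord0; apply/esym/eqP.
  by rewrite -size_poly_leq0.
pose b := weight P m * 'C(m + n, m)%:R; pose q1 := (g`_n / b) *: 'X^(m + n).
have b0 : b != 0.
  by rewrite mulf_neq0// pnatr_eq0 -lt0n bin_gt0 leq_addr.
have sq1 : (size q1 <= (m + n).+1)%N.
  by rewrite (leq_trans (size_scale_leq _ _))// size_polyXn.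
have top : (shiftop P q1)`_n = g`_n.
  rewrite coef_shiftop_top// coefZ coefXn eqxx mulr1 -mulr_natr mulrCA.
  by rewrite divfK.
have [|q2 [q2low sq2 q2E]] := IHn (g - shiftop P q1).
  apply/leq_sizeP => j; rewrite leq_eqVlt => /predU1P[<-|nj].
    by rewrite coefB top subrr.
  rewrite coefB !nth_default ?subrr ?(leq_trans gn)//.
  by apply: leq_trans nj; apply: size_shiftop; rewrite addnS.
exists (q1 + q2); split=> [j jm||].
- rewrite coefD q2low// coefZ coefXn ltn_eqF ?mulr0 ?addr0//.
  by rewrite (leq_trans jm)// leq_addr.
- by rewrite (leq_trans (size_polyD _ _))// geq_max addnS sq1 leqW.
- by rewrite -[q1]scale1r shiftop_linearr scale1r q2E addrC subrK.
Qed.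

End Order.
End ShiftOperator.

(** * Families of vectors and matrices of operators *)

Section Families.
Variables (R : realType) (V : lmodType R).

Lemma comb_is_linear d (b : 'I_d -> V) : linear (comb b).
Proof.
move=> c x y; rewrite /comb scaler_sumr -big_split /=; apply: eq_bigr => i _.
by rewrite !mxE scalerDl scalerA.
Qed.

HB.instance Definition _ d (b : 'I_d -> V) :=
  GRing.isLinear.Build R 'cV[R]_d V _ (comb b) (comb_is_linear b).

Lemma coefcolK d (b : 'I_d -> V) :
  injective (comb b) -> cancel (comb b) (coefcol b).
Proof.
by move=> b_inj c; apply: xget_subset1 => // x y /= -> /b_inj.
Qed.

Lemma comb_coefcol d (b : 'I_d -> V) v : spanf b v -> comb b (coefcol b v) = v.
Proof.
move=> [c _ cv]; apply/esym.
exact: (@xgetPex _ 0 [set c | v = comb b c] (ex_intro _ c (esym cv))).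
Qed.

Lemma comb_opmx d (b : 'I_d -> V) (F : {linear V -> V}) c :
  (forall i, spanf b (F (b i))) -> comb b (opmx b F *m c) = F (comb b c).
Proof.
move=> Fb; rewrite {2}/comb linear_sum /=.
under eq_bigr do rewrite linearZ /= -(comb_coefcol (Fb _)) /comb scaler_sumr.
rewrite exchange_big /=; apply: eq_bigr => i _.
rewrite mxE scaler_suml; apply: eq_bigr => j _.
by rewrite mxE scalerA mulrC.
Qed.

Lemma comb_polymx d (b : 'I_d -> V) (F : V -> V) (M : 'M[R]_d) k a c :
  (forall x, comb b (M *m x) = F (comb b x)) ->
  comb b (polymx k a M *m c) =
  iter k F (comb b c) + \sum_(1 <= i < k.+1) a i *: iter (k - i) F (comb b c).
Proof.
move=> MF; have MXF n : comb b (M ^+ n *m c) = iter n F (comb b c).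
  elim: n => [|n /= <-]; first by rewrite expr0 mul1mx.
  by rewrite exprS -mulmxA MF.
rewrite mulmxDl linearD /= MXF mulmx_suml linear_sum /=; congr (_ + _).
by apply: eq_bigr => i _; rewrite -scalemxAl linearZ /= MXF.
Qed.

Lemma comb_colsub d e (b : 'I_d -> V) (g : 'I_e -> 'I_d) c :
  comb b (colsub g 1%:M *m c) = comb (b \o g) c.
Proof.
rewrite /comb; under eq_bigr do rewrite mxE scaler_suml.
rewrite exchange_big /=; apply: eq_bigr => j _.
rewrite (bigD1 (g j)) //= big1 => [|i /negPf ij]; last first.
  by rewrite !mxE ij mul0r scale0r.
by rewrite !mxE eqxx mul1r addr0.
Qed.

(** This lets a coordinate column whose tail vanishes be read in a shorter
    family; it accounts for the rows removed from a matrix. *)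
Lemma comb_widen (v : nat -> V) d e (de : (d <= e)%N) (x : 'cV[R]_e) :
  (forall i : 'I_e, (d <= i)%N -> x i 0 = 0) ->
  comb (fun i : 'I_e => v i) x =
  comb (fun i : 'I_d => v i) (rowsub (widen_ord de) x).
Proof.
move=> x0; rewrite /comb (bigID (fun i : 'I_e => (i < d)%N)) /=.
rewrite [X in _ + X]big1 ?addr0 => [|i]; last first.
  by rewrite -leqNgt => /x0 ->; rewrite scale0r.
by rewrite big_ord_narrow; apply: eq_bigr => i _; rewrite mxE.
Qed.

End Families.

Section RealLinear.
Variables (R : realType) (V : lmodType R) (f : {poly R[i]} -> V).

(** Linearity over the real scalars only, since taking real parts is not
    linear over the complex ones. *)
Definition real_linear :=
  forall c p q, f (real_complex R c *: p + q) = c *: f p + f q.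

Hypothesis f_lin : real_linear.

Lemma real_linear0 : f 0 = 0.
Proof.
have := f_lin (-1) 0 0; rewrite scaler0 addr0 scaleN1r => ->.
by rewrite addNr.
Qed.

Lemma real_linearD p q : f (p + q) = f p + f q.
Proof. by have := f_lin 1 p q; rewrite rmorph1 !scale1r. Qed.

Lemma real_linearB p q : f (p - q) = f p - f q.
Proof. by apply/eqP; rewrite eq_sym subr_eq -real_linearD subrK. Qed.

Lemma real_linear_sum I (r : seq I) (c : I -> R) (p : I -> {poly R[i]}) :
  f (\sum_(i <- r) real_complex R (c i) *: p i) = \sum_(i <- r) c i *: f (p i).
Proof.
elim: r => [|i r IHr]; first by rewrite !big_nil real_linear0.
by rewrite !big_cons f_lin IHr.
Qed.

End RealLinear.

(** * Quasi-polynomials *)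

Section QuasiPolynomials.
Variables (R : realType) (mu : R[i]).
Local Notation "c %:C" := (real_complex R c).
Implicit Types p q : {poly R[i]}.

Definition quasi q : SR R :=
  cls ((fun n => complex.Re (q.[n%:R] * mu ^+ n)) : rseq R).

Lemma quasi_linear : real_linear quasi.
Proof.
move=> c p q; rewrite /quasi -[c *: _]clsZ -clsD; congr cls; apply/funext => n.
transitivity (c * complex.Re (p.[n%:R] * mu ^+ n) +
            complex.Re (q.[n%:R] * mu ^+ n)); last by [].
rewrite hornerD hornerZ mulrDl -mulrA.
by case: (p.[_] * _) (q.[_] * _) => [x y] [z t] /=; rewrite mul0r subr0.
Qed.

Lemma iterT_quasi j q : iter j (@T R) (quasi q) = quasi (shiftop mu 'X^j q).
Proof.
have iterT y : iter j (@T R) (cls y) = cls ((fun n => y (n + j)%N) : rseq R).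
  elim: j => [|j /= ->]; first by congr cls; apply/funext => n; rewrite addn0.
  by rewrite T_cls; congr cls; apply/funext => n; rewrite addnS.
rewrite iterT; congr cls; apply/funext => n.
by rewrite horner_shiftopXn natrD -mulrA -exprD addnC.
Qed.

Lemma map_charpoly k a : map_poly (real_complex R) (charpoly_eq k a) =
  'X^k + \sum_(1 <= i < k.+1) (a i)%:C *: 'X^(k - i).
Proof.
rewrite /charpoly_eq rmorphD /= map_polyXn rmorph_sum /=; congr (_ + _).
by apply: eq_bigr => i _; rewrite map_polyZ map_polyXn.
Qed.

Lemma charpoly_neq0 k a :
  map_poly (real_complex R) (charpoly_eq k a) != 0.
Proof.
apply/eqP => /(congr1 (fun p : {poly R[i]} => p`_k)) /eqP; apply/negP.
rewrite map_charpoly coefD coefXn eqxx coef_sum big_nat_cond big1.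
  by rewrite addr0 coef0 oner_eq0.
move=> i /andP[/andP[i0 ik] _]; rewrite coefZ coefXn gtn_eqF ?mulr0//.
by rewrite ltn_subrL i0 (leq_trans i0).
Qed.

(** Both sides are additive and real-linear in the characteristic polynomial,
    so the monomials, i.e. the powers of the shift, suffice. *)
Lemma Rop_quasi k a q : Rop k a (quasi q) =
  quasi (shiftop mu (map_poly (real_complex R) (charpoly_eq k a)) q).
Proof.
have lin : real_linear (fun P => quasi (shiftop mu P q)).
  by move=> c P Q; rewrite shiftop_linearl quasi_linear.
rewrite map_charpoly (real_linearD lin) (real_linear_sum lin) /Rop iterT_quasi.
by congr (_ + _); apply: eq_bigr => i _; rewrite iterT_quasi.
Qed.

Hypothesis mu_nonreal : complex.Im mu != 0.

Lemma mu_neq0 : mu != 0.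
Proof. by apply: contraNneq mu_nonreal => ->. Qed.

(** The kernel of [quasi] is stable under every equation with real
    coefficients.  The one with characteristic roots [mu] and its conjugate
    lowers the degree by one because [mu] is a simple root, so by induction
    on the degree [q] is a constant [c].  If [Re (c mu)] and [Re (c mu^2)]
    both vanish then [c mu] is imaginary and [c mu * Im mu = 0], whence
    [c = 0].  Index [0] is not available, as classes ignore it. *)
Lemma quasi_eq0 q : quasi q = 0 -> q = 0.
Proof.
have [n] := ubnP (size q); elim: n q => // n IHn q; rewrite ltnS => qn q0.
pose a i := if i == 1%N then - (complex.Re mu *+ 2)
            else complex.Re mu ^+ 2 + complex.Im mu ^+ 2.
set P := map_poly (real_complex R) (charpoly_eq 2 a).
have PE : P = ('X - mu%:P) * ('X - (conjc mu)%:P).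
  have a1 : (a 1%N)%:C = - (mu + conjc mu).
    rewrite /a /=; case: (mu) => x y /=.
    by apply/eqP; rewrite eq_complex /= subrr oppr0 mulr2n !eqxx.
  have a2 : (a 2%N)%:C = mu * conjc mu.
    rewrite /a /=; case: (mu) => x y /=.
    apply/eqP; rewrite eq_complex /= mulrN opprK mulrN [y * x]mulrC addNr.
    by rewrite !eqxx.
  rewrite /P map_charpoly big_nat_recr //= big_nat1 a1 a2 -!mul_polyC.
  by rewrite polyCN polyCD polyCM; ring.
have Pmup : mup mu P = 1%N.
  rewrite PE mupMl ?(mup_XsubCX 1) ?eqxx// root_XsubC.
  apply: contraNneq mu_nonreal.
  case: (mu) => x y [/eqP]; rewrite -subr_eq0 opprK -mulr2n.
  by rewrite mulrn_eq0.
have [w0 w1] := weight_mup mu_neq0 (charpoly_neq0 2 a : P != 0).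
rewrite Pmup in w0 w1.
have Pq0 : shiftop mu P q = 0.
  have [q00|qN0] := eqVneq q 0.
    by rewrite q00 /shiftop size_poly0 big_ord0.
  apply: IHn; last first.
    rewrite -Rop_quasi q0 /Rop; have iter0 j : iter j (@T R) 0 = 0.
      by elim: j => //= j ->; rewrite linear0.
    rewrite iter0 big1 ?addr0// => i _; by rewrite iter0 scaler0.
  apply: leq_trans qn; rewrite -[X in (_ < X)%N]prednK ?size_poly_gt0// ltnS.
  by apply: (size_shiftop w0); rewrite add1n prednK ?size_poly_gt0.
have /size1_polyC qC := shiftop_eq0 w0 w1 Pq0.
move: q0; rewrite qC -(real_linear0 quasi_linear); set c := q`_0.
move/cls_eqP => c0; suff -> : c = 0 by [].
have Re1 : complex.Re (c * mu) = 0.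
  by have := c0 1%N isT; rewrite hornerC horner0 mul0r.
have Re2 : complex.Re (c * mu * mu) = 0.
  by have := c0 2%N isT; rewrite hornerC horner0 mul0r expr2 mulrA.
apply/eqP; have := mu_neq0; rewrite -[c == 0]orbF => /negPf <-.
rewrite -mulf_eq0; move: (c * mu) Re1 Re2 mu_nonreal => [x y] /= ->.
case: (mu) => u v /=; rewrite mul0r sub0r => /eqP.
by rewrite oppr_eq0 mulf_eq0 => /orP[/eqP -> //|->].
Qed.

Lemma quasi_inj : injective quasi.
Proof.
move=> p q pq; apply/eqP; rewrite -subr_eq0; apply/eqP; apply: quasi_eq0.
by rewrite (real_linearB quasi_linear) pq subrr.
Qed.

End QuasiPolynomials.

(** * Real coordinates of complex polynomials *)

Section Coordinates.
Variable R : realType.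
Local Notation "c %:C" := (real_complex R c).
Implicit Types (p q : {poly R[i]}).

(** The polynomial that [quasi] sends to the basis term number [i]: the factor
    [- i] turns a cosine, the real part, into a sine. *)
Definition mono i : {poly R[i]} :=
  (if odd i then 1 else Complex 0 (-1)) *: 'X^(i./2).

(** The coordinate functional dual to [mono]; the sign in the even case
    matches the factor [- i] there. *)
Definition crd i q : R :=
  if odd i then complex.Re q`_(i./2) else - complex.Im q`_(i./2).

Lemma crd_linear i : real_linear (crd i : {poly R[i]} -> R^o).
Proof.
move=> c p q; rewrite /crd coefD coefZ /GRing.scale /=.
case: (p`_ _) (q`_ _) => [x y] [z t] /=.
case: odd; first by rewrite mul0r subr0.
by rewrite mul0r addr0 opprD mulrN.
Qed.

Lemma crd_mono i k : crd i (mono k) = (k == i)%:R.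
Proof.
rewrite /crd /mono coefZ coefXn [in k == i]eq_sym.
have -> : (i == k) = (odd i == odd k) && (i./2 == k./2).
  apply/eqP/andP => [-> |[/eqP ik /eqP ik2]]; first by rewrite !eqxx.
  by rewrite -(odd_double_half i) ik ik2 odd_double_half.
by case: (odd i) (odd k) => [] []; case: (_ == _) => /=;
  rewrite ?(mul0r, mulr0, mulr1, mul1r, oppr0, addr0, add0r, subr0, opprK).
Qed.

Lemma crd_eq0 j q : (q`_j == 0) = (crd j.*2 q == 0) && (crd j.*2.+1 q == 0).
Proof.
rewrite /crd /= odd_double /= doubleK uphalf_double oppr_eq0.
by case: q`_j => x y; rewrite eq_complex andbC.
Qed.

Lemma crd_inj p q : (forall i, crd i p = crd i q) -> p = q.
Proof.
move=> pq; apply/eqP; rewrite -subr_eq0; apply/eqP/polyP => j; rewrite coef0.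
by apply/eqP; rewrite crd_eq0 !(real_linearB (@crd_linear _)) !pq !subrr eqxx.
Qed.

Definition cut o d q := \sum_(i < d) (crd (o + i) q)%:C *: mono (o + i).

Lemma crd_sum_mono o d (c : 'I_d -> R) k :
  crd k (\sum_(i < d) (c i)%:C *: mono (o + i)) =
  \sum_(i < d) c i * (o + i == k)%:R.
Proof.
rewrite (real_linear_sum (@crd_linear k)); apply: eq_bigr => i _.
by rewrite crd_mono.
Qed.

Lemma crd_sum_mono_in o d (c : 'I_d -> R) (i : 'I_d) :
  crd (o + i) (\sum_(i < d) (c i)%:C *: mono (o + i)) = c i.
Proof.
rewrite crd_sum_mono (bigD1 i) //= eqxx mulr1 big1 ?addr0// => j ji.
by rewrite eqn_add2l val_eqE (negPf ji) mulr0.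
Qed.

Lemma crd_sum_mono_out o d (c : 'I_d -> R) k : ~~ (o <= k < o + d)%N ->
  crd k (\sum_(i < d) (c i)%:C *: mono (o + i)) = 0.
Proof.
move=> kN; rewrite crd_sum_mono big1// => j _.
have [ojk|] := eqVneq; last by rewrite mulr0.
by move: kN; rewrite -ojk leq_addr ltn_add2l ltn_ord.
Qed.

Lemma crd_cut o d q k :
  crd k (cut o d q) = if (o <= k < o + d)%N then crd k q else 0.
Proof.
case: ifPn => [/andP[ok kd]|/crd_sum_mono_out -> //].
have kod : (k - o < d)%N by rewrite ltn_subLR.
have := crd_sum_mono_in o (fun i : 'I_d => crd (o + i) q) (Ordinal kod).
by rewrite /= subnKC.
Qed.

(** The polynomials whose coordinates are supported on [o, o + d); these
    correspond to the span of the basis terms with those numbers. *)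
Definition window o d q := forall k, ~~ (o <= k < o + d)%N -> crd k q = 0.

Lemma window_cut o d q : window o d (cut o d q).
Proof. by move=> k kN; rewrite crd_cut (negPf kN). Qed.

Lemma cut_id o d q : window o d q -> cut o d q = q.
Proof.
by move=> q0; apply: crd_inj => k; rewrite crd_cut; case: ifPn => // /q0.
Qed.

Lemma crd_ge_size q k : ((size q).*2 <= k)%N -> crd k q = 0.
Proof.
move=> qk; rewrite /crd nth_default ?oppr0 ?if_same//.
by rewrite -(doubleK (size q)) half_leq.
Qed.

Lemma windowP m n q :
  window (2 * m) (2 * n) q <->
  (forall j, (j < m)%N -> q`_j = 0) /\ (size q <= m + n)%N.
Proof.
split=> [wq|[q0 sq] k].
  split=> [j jm|]; last (apply/leq_sizeP => j mnj); apply/eqP;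
    rewrite crd_eq0 !wq ?eqxx// -mulnDr !mul2n negb_and -ltnNge -leqNgt.
  - by rewrite ltn_Sdouble jm.
  - by rewrite ltn_double jm.
  - by rewrite leqW ?orbT// leq_double.
  - by rewrite leq_double mnj orbT.
rewrite -mulnDr !mul2n negb_and -ltnNge -leqNgt => /orP[km|mnk].
  rewrite /crd q0 ?oppr0 ?if_same//.
  by rewrite ltn_half_double.
by rewrite crd_ge_size// (leq_trans _ mnk)// leq_double.
Qed.

Lemma window0P n q : window 0 (2 * n) q <-> (size q <= n)%N.
Proof. by split=> [/(windowP 0)[]|sq]; last exact/(windowP 0). Qed.

End Coordinates.

(** * The equation on the spans *)

Section Bases.
Variables (R : realType) (mu : R[i]) (phi : R).
Hypotheses (mu_nonreal : complex.Im mu != 0) (mu_arg : is_arg mu phi).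
Local Notation "c %:C" := (real_complex R c).
Local Notation quasi := (quasi mu).

Lemma de_moivre n :
  Complex (cos phi) (sin phi) ^+ n =
  Complex (cos (n%:R * phi)) (sin (n%:R * phi)).
Proof.
elim: n => [|n IHn]; first by rewrite mul0r cos0 sin0.
rewrite exprS IHn -natr1 mulrDl mul1r addrC cosD sinD.
by apply/eqP; rewrite eq_complex /= addrC eqxx [X in _ == X]addrC eqxx.
Qed.

Lemma cls_bseq i : cls (Defs.bseq mu phi i) = quasi (mono R i).
Proof.
congr cls; apply/funext => n.
have muE : mu ^+ n =
    (cabs mu ^+ n)%:C * Complex (cos (n%:R * phi)) (sin (n%:R * phi)).
  by rewrite {1}mu_arg exprMn de_moivre rmorphXn.
have natE : (n%:R : R[i]) ^+ i./2 = (n%:R ^+ i./2)%:C.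
  by rewrite rmorphXn rmorph_nat.
rewrite /Defs.bseq /mono muE hornerZ hornerXn natE.
by move: (_ ^+ i./2) (_ ^+ n) => x y; case: odd => /=; ring.
Qed.

(** A common form for the three bases: the offset [o] is [0] for [basL] and
    [basK] and [2 * m] for [basLm]. *)
Definition fam o d : 'I_d -> SR R := fun i => cls (Defs.bseq mu phi (o + i)).
Arguments fam : clear implicits.

Lemma comb_fam o d (c : 'cV[R]_d) :
  comb (fam o d) c = quasi (\sum_(i < d) (c i 0)%:C *: mono R (o + i)).
Proof.
rewrite (real_linear_sum (quasi_linear mu)); apply: eq_bigr => i _.
by rewrite -cls_bseq.
Qed.

Lemma comb_fam_inj o d : injective (comb (fam o d)).
Proof.
move=> c e; rewrite !comb_fam => /(quasi_inj mu_nonreal) ce.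
apply/colP => i; have := crd_sum_mono_in o (fun i => c i 0) i.
by rewrite ce crd_sum_mono_in.
Qed.

Lemma spanf_famP o d y :
  spanf (fam o d) y <-> exists2 q, window o d q & y = quasi q.
Proof.
split=> [[c _ <-]|[q wq ->]].
  rewrite comb_fam; eexists; last by [].
  by move=> k; apply: crd_sum_mono_out.
exists (\col_i crd (o + i) q) => //.
rewrite comb_fam -[in RHS](cut_id wq); congr quasi; apply: eq_bigr => i _.
by rewrite mxE.
Qed.

Lemma spanf_fam_quasi o d q : spanf (fam o d) (quasi q) <-> window o d q.
Proof.
split=> [/spanf_famP[p wp /(quasi_inj mu_nonreal) ->] //|wq].
by apply/spanf_famP; exists q.
Qed.

Section Operator.
Variables (k : nat) (a : nat -> R).
Let P := map_poly (real_complex R) (charpoly_eq k a).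

Lemma spL_T s y : spL mu phi s y -> spL mu phi s (T y).
Proof.
move=> /(spanf_famP 0 (2 * s.+1))[q /window0P sq ->].
rewrite -[T _]/(iter 1 (@T R) _) iterT_quasi.
apply/(spanf_famP 0 (2 * s.+1)); eexists; last by [].
by apply/window0P; apply: (@size_shiftop _ mu _ 0).
Qed.

Lemma comb_Rmx s c :
  comb (basL mu phi s) (Rmx k a mu phi s *m c) =
  Rop k a (comb (basL mu phi s) c).
Proof.
apply: comb_polymx => x; apply: (comb_opmx (F := T (R := R))) => i.
apply: spL_T; exists (delta_mx i 0) => //.
rewrite /comb (bigD1 i) //= big1 => [|j /negPf ji]; rewrite mxE.
  by rewrite !eqxx scale1r addr0.
by rewrite ji scale0r.
Qed.

Variable m : nat.
Hypothesis P_mup : mup mu P = m.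

Let weight_P := weight_mup (mu_neq0 mu_nonreal) (charpoly_neq0 k a : P != 0).

Lemma weight_lt e : (e < m)%N -> weight mu P e = 0.
Proof. by rewrite -P_mup => /weight_P.1. Qed.

Lemma weight_m : weight mu P m != 0.
Proof. by have := weight_P.2; rewrite P_mup. Qed.

Lemma Rop_spL s y : spL mu phi (m + s) y -> spL mu phi s (Rop k a y).
Proof.
move=> /(spanf_famP 0 (2 * (m + s).+1))[q /window0P sq ->].
rewrite Rop_quasi; apply/(spanf_fam_quasi 0 (2 * s.+1))/window0P.
by apply: (size_shiftop weight_lt); rewrite addnS.
Qed.

Lemma ker_Rop q : Rop k a (quasi q) = 0 <-> (size q <= m)%N.
Proof.
rewrite Rop_quasi -(real_linear0 (quasi_linear mu)); split.
  by move/(quasi_inj mu_nonreal)/(shiftop_eq0 weight_lt weight_m).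
move=> qm; congr quasi; apply/eqP; rewrite -size_poly_leq0.
by apply: (size_shiftop weight_lt); rewrite addn0.
Qed.

Lemma Rop_comb_onto s f : spL mu phi s f ->
  exists c, Rop k a (comb (basLm mu phi m s) c) = f.
Proof.
move=> /(spanf_famP 0 (2 * s.+1))[g /window0P sg ->].
have [q [q0 sq qg]] := shiftop_onto weight_lt weight_m sg.
have /(spanf_famP (2 * m) (2 * s.+1))[c _ cq] :
    exists2 q', window (2 * m) (2 * s.+1) q' & quasi q = quasi q'.
  by exists q => //; apply/windowP.
by exists c; rewrite [comb _ _]cq Rop_quasi qg.
Qed.

Lemma RopB x y : Rop k a (x - y) = Rop k a x - Rop k a y.
Proof.
have iterB j : iter j (@T R) (x - y) = iter j (@T R) x - iter j (@T R) y.
  by elim: j => //= j ->; rewrite linearB.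
rewrite /Rop iterB opprD addrACA -sumrB; congr (_ + _).
by apply: eq_bigr => i _; rewrite iterB scalerBr.
Qed.

(** The kernel has degree less than [m], while the polynomials behind
    [basLm] have no terms of degree less than [m]. *)
Lemma Rop_comb_inj s : injective (fun c => Rop k a (comb (basLm mu phi m s) c)).
Proof.
move=> c e ce; apply: (@comb_fam_inj (2 * m) (2 * s.+1)).
apply/eqP; rewrite -subr_eq0 -linearB /=; apply/eqP.
have [q wq qE] : exists2 q, window (2 * m) (2 * s.+1) q &
    comb (fam (2 * m) (2 * s.+1)) (c - e) = quasi q.
  by apply/spanf_famP; exists (c - e).
have /ker_Rop qm : Rop k a (quasi q) = 0.
  by rewrite -qE linearB RopB ce subrr.
rewrite qE -(real_linear0 (quasi_linear mu)); congr quasi.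
apply/polyP => j; rewrite coef0; have [q0 _] := (windowP m s.+1 q).1 wq.
by case: (ltnP j m) => [/q0 //|mj]; rewrite nth_default// (leq_trans qm).
Qed.

(** Padding [c] with [2 * m] leading zeros, which [colsub sel 1%:M] does, turns
    the untrimmed matrix into its last columns.  Its image under the operator
    has degree at most [s], so the last [2 * m] coordinates are zero and may be
    dropped. *)
Lemma comb_Rmx_del s c :
  comb (basL mu phi s) (Rmx_del k a mu phi m s *m c) =
  Rop k a (comb (basLm mu phi m s) c).
Proof.
set sel := fun j => cast_ord (dim_eq m s) (rshift (2 * m) j).
set y := Rmx k a mu phi (m + s) *m (colsub sel 1%:M *m c).
have -> : Rmx_del k a mu phi m s *m c = rowsub (widen_ord (dim_le m s)) y.
  rewrite /y mulmxA -mul_rowsub_mx; congr (_ *m c).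
  by rewrite mulmx_colsub mulmx1; apply/matrixP => i j; rewrite !mxE.
have Ry : Rop k a (comb (basLm mu phi m s) c) = comb (basL mu phi (m + s)) y.
  by rewrite /y comb_Rmx comb_colsub.
rewrite Ry; apply/esym.
apply: (@comb_widen _ _ (fun i => cls (Defs.bseq mu phi i))) => i si.
have : spL mu phi s (Rop k a (comb (basLm mu phi m s) c)).
  by apply: Rop_spL; exists (colsub sel 1%:M *m c); rewrite ?comb_colsub.
rewrite Ry [comb _ _](comb_fam 0) => /(spanf_fam_quasi 0 (2 * s.+1)) /(_ i).
rewrite /= add0n -leqNgt => /(_ si).
by rewrite (crd_sum_mono_in 0 (fun i => y i 0)).
Qed.

Lemma spL_decomp s :
  direct_sum (spL mu phi (m + s)) (spK mu phi m) (spLm mu phi m s).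
Proof.
split; apply/seteqP; split.
- move=> y /(spanf_famP 0 (2 * (m + s).+1))[q wq ->].
  exists (quasi (cut 0 (2 * m) q)).
    exact/(spanf_fam_quasi 0 (2 * m))/window_cut.
  exists (quasi (q - cut 0 (2 * m) q)).
    apply/(spanf_fam_quasi (2 * m) (2 * s.+1)) => j jN.
    rewrite (real_linearB (@crd_linear _ _)) crd_cut add0n /=.
    case: ltnP => jm; rewrite ?subrr// wq ?subr0//.
    by move: jN; rewrite dim_eq jm.
  by rewrite -(real_linearD (quasi_linear mu)) addrC subrK.
- move=> y [u /(spanf_famP 0 (2 * m))[p wp ->]].
  move=> [v /(spanf_famP (2 * m) (2 * s.+1))[q wq ->]] <-.
  rewrite -(real_linearD (quasi_linear mu)).
  apply/(spanf_fam_quasi 0 (2 * (m + s).+1)) => j; rewrite /= -dim_eq => jN.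
  rewrite (real_linearD (@crd_linear _ _)) wp ?wq ?addr0//.
    by apply: contra jN => /andP[].
  by apply: contra jN => /leq_trans ->//; rewrite leq_addr.
- move=> y [/(spanf_famP 0 (2 * m))[q wq ->]].
  move=> /(spanf_fam_quasi (2 * m) (2 * s.+1)) wq'.
  rewrite /= -(real_linear0 (quasi_linear mu)); congr quasi.
  apply: crd_inj => j.
  rewrite (real_linear0 (@crd_linear _ _)).
  case: (ltnP j (2 * m)) => jm.
    by rewrite wq'// negb_and -ltnNge jm.
  by rewrite wq// negb_and -leqNgt add0n jm orbT.
- move=> _ ->; split; rewrite -(real_linear0 (quasi_linear mu)).
    apply/(spanf_fam_quasi 0 (2 * m)) => j _.
    by rewrite (real_linear0 (@crd_linear _ _)).
  apply/(spanf_fam_quasi (2 * m) (2 * s.+1)) => j _.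
  by rewrite (real_linear0 (@crd_linear _ _)).
Qed.

Lemma spK_ker s :
  spK mu phi m = [set y | spL mu phi (m + s) y /\ Rop k a y = 0].
Proof.
apply/seteqP; split=> [y|y [/(spanf_famP 0 (2 * (m + s).+1))[q _ ->]]].
  move=> /(spanf_famP 0 (2 * m))[q /window0P sq ->]; split.
    apply/(spanf_fam_quasi 0 (2 * (m + s).+1))/window0P.
    by rewrite (leq_trans sq)// -addnS leq_addr.
  exact/ker_Rop.
move=> /ker_Rop sq; apply/(spanf_fam_quasi 0 (2 * m)).
exact/window0P.
Qed.

Lemma Rmx_delP s f c : spL mu phi s f ->
  Rmx_del k a mu phi m s *m c = coefcol (basL mu phi s) f <->
  Rop k a (comb (basLm mu phi m s) c) = f.
Proof.
move=> /comb_coefcol fE; rewrite -comb_Rmx_del -[X in _ <-> _ = X]fE.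
by split=> [->//|]; apply: (@comb_fam_inj 0 (2 * s.+1)).
Qed.

Lemma Rmx_del_unique s f : spL mu phi s f ->
  exists! c, Rmx_del k a mu phi m s *m c = coefcol (basL mu phi s) f.
Proof.
move=> fs; have [c cf] := Rop_comb_onto fs; exists c.
split=> [|e /(Rmx_delP _ fs) ef]; first exact/Rmx_delP.
by apply: (@Rop_comb_inj s); rewrite /= cf ef.
Qed.

End Operator.

End Bases.

Lemma Rmx_del0 (R : realType) k a (mu : R[i]) phi s :
  Rmx_del k a mu phi 0 s = Rmx k a mu phi s.
Proof.
apply/matrixP => i j; rewrite mxE.
by congr (Rmx k a mu phi s _ _); apply: val_inj.
Qed.

Theorem theorem4 (R : realType) (k : nat) (a : nat -> R) (mu : R[i]) (phi : R)
    (s : nat) (f : SR R)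
    (hk : (1 <= k)%N) (hak : a k != 0)
    (hmu : complex.Im mu != 0) (hphi : is_arg mu phi)
    (hf : spL mu phi s f) :
  let P : {poly R[i]} := map_poly (real_complex R) (charpoly_eq k a) in
  let fcol := coefcol (basL mu phi s) f in
  (~~ root P mu ->
    [/\ exists y0 : SR R, spL mu phi s y0 /\ Rop k a y0 = f,
        forall yc : 'cV[R]_(2 * s.+1),
          (exists y0 : SR R,
             [/\ spL mu phi s y0, Rop k a y0 = f
               & coefcol (basL mu phi s) y0 = yc])
          <-> Rmx k a mu phi s *m yc = fcol
      & exists! yc : 'cV[R]_(2 * s.+1), Rmx k a mu phi s *m yc = fcol])
  /\
  (forall m : nat, (1 <= m)%N -> root P mu -> mup mu P = m ->
    [/\ exists y0 : SR R, spL mu phi (m + s) y0 /\ Rop k a y0 = f,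
        direct_sum (spL mu phi (m + s)) (spK mu phi m) (spLm mu phi m s),
        spK mu phi m = [set y | spL mu phi (m + s) y /\ Rop k a y = 0],
        forall yc : 'cV[R]_(2 * s.+1),
          (exists y0 yp : SR R,
             [/\ spL mu phi (m + s) y0, Rop k a y0 = f,
                 is_proj (spLm mu phi m s) (spK mu phi m) y0 yp
               & coefcol (basLm mu phi m s) yp = yc])
          <-> Rmx_del k a mu phi m s *m yc = fcol
      & exists! yc : 'cV[R]_(2 * s.+1),
          Rmx_del k a mu phi m s *m yc = fcol]).
Proof.
move=> P fcol; split=> [Pmu|m m0 Pmu Pm].
  have Pm : mup mu P = 0%N by apply: mupNroot.
  have [c cf] := Rop_comb_onto hmu hphi Pm hf.
  have coefK := coefcolK (@comb_fam_inj _ mu phi hmu hphi 0 (2 * s.+1)).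
  have RP yc : Rmx k a mu phi s *m yc = fcol <->
      Rop k a (comb (basL mu phi s) yc) = f.
    by rewrite -Rmx_del0; apply: (Rmx_delP hmu hphi Pm).
  split.
  - by exists (comb (basL mu phi s) c); split=> //; exists c.
  - move=> yc; rewrite RP; split=> [[_ [[e _ <-] ef <-]]|ycf].
      by rewrite [coefcol _ _]coefK.
    by exists (comb (basL mu phi s) yc); split=> //; exists yc.
  - by rewrite -Rmx_del0; apply: (Rmx_del_unique hmu hphi Pm).
have [c cf] := Rop_comb_onto hmu hphi Pm hf.
have coefK := coefcolK (@comb_fam_inj _ mu phi hmu hphi (2 * m) (2 * s.+1)).
have dsum := spL_decomp hmu hphi m s.
have kerE := spK_ker hmu hphi Pm s.
have K0 : spK mu phi m 0 by have [_ /seteqP[_ /(_ 0 erefl)[]]] := dsum.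
have subL e : spL mu phi (m + s) (comb (basLm mu phi m s) e).
  rewrite dsum.1; exists 0 => //; exists (comb (basLm mu phi m s) e).
    by exists e.
  by rewrite add0r.
split=> //.
- by exists (comb (basLm mu phi m s) c).
- move=> yc; rewrite (Rmx_delP hmu hphi Pm _ hf).
  split=> [[y0 [_ [_ y0f [[e _ <-] Ky0] <-]]]|ycf].
    rewrite [coefcol _ _]coefK -[RHS]y0f.
    by move: Ky0; rewrite kerE => -[_]; rewrite RopB => /subr0_eq.
  exists (comb (basLm mu phi m s) yc), (comb (basLm mu phi m s) yc).
  by split=> //; split; [exists yc|rewrite subrr].
- exact: (Rmx_del_unique hmu hphi Pm hf).
Qed.
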